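(* The variety of orthogroupoids has the strong amalgamation property: for all orthogroupoids $\mathbf A,\mathbf B_1,\mathbf B_2$ with $A\neq\emptyset$ and embeddings $i:\mathbf A\to\mathbf B_1$, $j:\mathbf A\to\mathbf B_2$, there exist an orthogroupoid $\mathbf D$ and embeddings $h:\mathbf B_1\to\mathbf D$, $k:\mathbf B_2\to\mathbf D$ such that $h\circ i=k\circ j$ and $h(i(A))=k(j(A))=h(B_1)\cap k(B_2)$.
   Context: An orthogroupoid is an algebra $\langle D,+,',1\rangle$ of type $(2,1,0)$, with $0:=1'$, satisfying: (a) $x''\approx x$; (b) $0+x\approx x$ and $x+1\approx 1$; (c) $x+x'\approx 1$; (d) for all $x,z$: if $x+z=z$ and $x'+z=z$ then $z=1$; (e) $(((z+y)'+(z+x))'+(z+y)')+z'\approx z'$; (f) $x+(x+y)\approx x+y$ and $y+(x+y)\approx x+y$. Equivalently, (d) may be replaced by the identity $1+x\approx 1$, so orthogroupoids form a variety. *)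

(* Defs.v *)
From mathcomp Require Import all_boot.
From mathcomp Require Import boolp classical_sets.

Set Implicit Arguments.
Unset Strict Implicit.
Unset Printing Implicit Defensive.

Declare Scope ogpd_scope.
Delimit Scope ogpd_scope with ogpd.

Section OrthogroupoidLaws.
Variables (D : Type) (add : D -> D -> D) (compl : D -> D) (one : D).

Local Notation "x + y" := (add x y).
Local Notation "x ^'" := (compl x).
Local Notation "1" := one.
Local Notation "0" := (1^').

Record orthogroupoid_laws : Prop := OrthogroupoidLawsBuild {
  ogpd_complK : forall x, x^'^' = x;
  ogpd_add0 : forall x, 0 + x = x;
  ogpd_addx1 : forall x, x + 1 = 1;
  ogpd_addxC : forall x, x + x^' = 1;
  ogpd_eq1 : forall x z, x + z = z -> x^' + z = z -> z = 1;
  ogpd_orth : forall x y z,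
    (((z + y)^' + (z + x))^' + (z + y)^') + z^' = z^';
  ogpd_addKl : forall x y, x + (x + y) = x + y;
  ogpd_addKr : forall x y, y + (x + y) = x + y
}.

End OrthogroupoidLaws.

Record orthogroupoid := Orthogroupoid {
  ogpd_sort :> Type;
  ogpd_add : ogpd_sort -> ogpd_sort -> ogpd_sort;
  ogpd_compl : ogpd_sort -> ogpd_sort;
  ogpd_one : ogpd_sort;
  ogpdP : orthogroupoid_laws ogpd_add ogpd_compl ogpd_one
}.

Arguments ogpd_one {o}.

Notation "x + y" := (ogpd_add x y) : ogpd_scope.
Notation "x ^'" := (ogpd_compl x) : ogpd_scope.
Notation "1" := ogpd_one : ogpd_scope.

Record ogpd_embedding (A B : orthogroupoid) (f : A -> B) : Prop :=
  OgpdEmbedding {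
    ogpd_embD : forall x y : A, f (x + y)%ogpd = (f x + f y)%ogpd;
    ogpd_embC : forall x : A, f (x^')%ogpd = ((f x)^')%ogpd;
    ogpd_emb1 : f 1%ogpd = 1%ogpd;
    ogpd_emb_inj : injective f
  }.

(* Main.v *)
From HB Require Import structures.
Require Import Defs.
From mathcomp Require Import all_boot.
From mathcomp Require Import boolp classical_sets.

(** The amalgam is the set-theoretic one: glue the [B i] along [A], keep the
operations of each [B i], and put [x + y := 1] whenever [x] and [y] lie in no
common [B i].  Writing [x ≼ y] for [x + y = y], axiom (e) says that
[z ≼ u] and [z ≼ w] imply [(u' + w)' + u' ≼ z'].  Since [1] lies in every
[B i], [x ≼ y] forces [x] and [y] into a common [B i].  Hence either
[u' + w = 1], and the conclusion is the antitonicity of complementation, or [z],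
[u] and [w] are pairwise in a common [B i]; then all three are, because an
element of two different [B i] comes from [A] and so belongs to every [B i]. *)

Set Implicit Arguments.
Unset Strict Implicit.
Unset Printing Implicit Defensive.

Local Open Scope classical_set_scope.
Local Open Scope ogpd_scope.

Definition induced_rel (T : Type) (add : T -> T -> T) (x y : T) : Prop :=
  add x y = y.

Section OrthogroupoidTheory.
Variable B : orthogroupoid.
Local Notation "x ≼ y" := (induced_rel (@ogpd_add B) x y) (at level 70).

Lemma ogpd_orth_rel (z u w : B) :
  z ≼ u -> z ≼ w -> (u^' + w)^' + u^' ≼ z^'.
Proof. by move=> zu zw; have := ogpd_orth (ogpdP B) w u z; rewrite zu zw. Qed.

Lemma ogpd_compl_anti (z u : B) : z ≼ u -> u^' ≼ z^'.
Proof.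
move=> zu; have := ogpd_orth_rel zu (ogpd_addx1 (ogpdP B) z).
by rewrite (ogpd_addx1 (ogpdP B)) (ogpd_add0 (ogpdP B)).
Qed.

End OrthogroupoidTheory.

Section WidePushout.
Variables (I : eqType) (A : Type) (B : I -> Type) (e : forall i, A -> B i).

Definition wide_pushout : Type :=
  (A + {i : I & {x : B i | ~ range (e i) x}})%type.

HB.instance Definition _ := gen_eqMixin wide_pushout.
HB.instance Definition _ := gen_choiceMixin wide_pushout.

Definition pushout_in (i : I) (x : B i) : wide_pushout :=
  match pselect (range (e i) x) with
  | left Ax => inl (s2val (cid2 Ax))
  | right nAx => inr (existT _ i (exist _ x nAx))
  end.

Lemma pushout_in_outside (i : I) (x : B i) (nAx : ~ range (e i) x) :
  pushout_in x = inr (existT _ i (exist _ x nAx)).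
Proof.
rewrite /pushout_in; case: pselect => [//|nAx'].
by rewrite (Prop_irrelevance nAx' nAx).
Qed.

Hypothesis e_inj : forall i, injective (e i).

Lemma pushout_in_base (i : I) (a : A) : pushout_in (e i a) = inl a.
Proof.
rewrite /pushout_in; case: pselect => [Aa|[]]; last by exists a.
by case: cid2 => a' _ /= /e_inj ->.
Qed.

Lemma pushout_in_inj (i : I) : injective (@pushout_in i).
Proof.
move=> x y; have [[a _ <-]|nAx] := pselect (range (e i) x);
  have [[b _ <-]|nAy] := pselect (range (e i) y).
- by rewrite !pushout_in_base => -[->].
- by rewrite pushout_in_base pushout_in_outside.
- by rewrite pushout_in_base pushout_in_outside.
- by rewrite !pushout_in_outside => -[]; apply: existT_inj2.
Qed.

Lemma pushout_in_meet (i j : I) (x : B i) (y : B j) :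
  i != j -> pushout_in x = pushout_in y -> exists2 a, x = e i a & y = e j a.
Proof.
move=> /eqP neq_ij; have [[a _ <-]|nAx] := pselect (range (e i) x);
  have [[b _ <-]|nAy] := pselect (range (e j) y).
- by rewrite !pushout_in_base => -[->]; exists b.
- by rewrite pushout_in_base pushout_in_outside.
- by rewrite pushout_in_base pushout_in_outside.
- by rewrite !pushout_in_outside => -[].
Qed.

Definition piece (i : I) : set wide_pushout := range (@pushout_in i).

Lemma piece_in (i : I) (x : B i) : piece i (pushout_in x).
Proof. by exists x. Qed.

Lemma piece_cover (i0 : I) (d : wide_pushout) : exists i, piece i d.
Proof.
case: d => [a|[i [x nAx]]].
- by exists i0; rewrite -(pushout_in_base i0); apply: piece_in.
- by exists i; rewrite -(pushout_in_outside nAx); apply: piece_in.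
Qed.

Lemma piece_overlap (i j k : I) (d : wide_pushout) :
  i != j -> piece i d -> piece j d -> piece k d.
Proof.
move=> neq_ij [x _ <-] [y _ /esym /(pushout_in_meet neq_ij)[a -> _]].
by rewrite pushout_in_base -(pushout_in_base k); apply: piece_in.
Qed.

End WidePushout.

Section Gluing.
Variables (I : eqType) (i0 : I) (A : orthogroupoid) (B : I -> orthogroupoid).
Variable e : forall i, A -> B i.
Hypothesis he : forall i, ogpd_embedding (e i).

Local Notation D := (wide_pushout e).
Local Notation ι := (pushout_in e).

Let e_inj i : injective (e i) := ogpd_emb_inj (he i).

Definition glue_one : D := inl 1.

Definition glue_compl (d : D) : D :=
  xget glue_one [set s | exists i (x : B i), d = ι x /\ s = ι (x^')].

(* The default value of [xget] is the sum of elements in no common piece. *)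
Definition glue_add (d d' : D) : D :=
  xget glue_one [set s | exists i (x y : B i),
    [/\ d = ι x, d' = ι y & s = ι (x + y)]].

Local Notation "d ⊕ d'" := (glue_add d d') (at level 50, left associativity).
Local Notation "d ^c" := (glue_compl d) (at level 2, format "d ^c").
Local Notation "d ≼ d'" := (induced_rel glue_add d d') (at level 70).

Lemma glue_oneE (i : I) : glue_one = ι (1 : B i).
Proof. by rewrite -(ogpd_emb1 (he i)) pushout_in_base. Qed.

Lemma pushout_in_compl_congr (i j : I) (x : B i) (y : B j) :
  ι x = ι y -> ι (x^') = ι (y^').
Proof.
case: (eqVneq i j) y => [<- y /(pushout_in_inj e_inj) -> //|neq_ij y].
move=> /(pushout_in_meet e_inj neq_ij)[a -> ->].
by rewrite -!(ogpd_embC (he _)) !pushout_in_base.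
Qed.

Lemma pushout_in_add_congr (i j : I) (x x' : B i) (y y' : B j) :
  ι x = ι y -> ι x' = ι y' -> ι (x + x') = ι (y + y').
Proof.
case: (eqVneq i j) y y' => [<- y y'|neq_ij y y'].
  by move=> /(pushout_in_inj e_inj) -> /(pushout_in_inj e_inj) ->.
move=> /(pushout_in_meet e_inj neq_ij)[a -> ->].
move=> /(pushout_in_meet e_inj neq_ij)[a' -> ->].
by rewrite -!(ogpd_embD (he _)) !pushout_in_base.
Qed.

Lemma glue_complE (i : I) (x : B i) : (ι x)^c = ι (x^').
Proof.
apply: xget_unique; first by exists i, x.
by move=> _ [j [y [xy ->]]]; apply/esym/pushout_in_compl_congr.
Qed.

Lemma glue_addE (i : I) (x y : B i) : ι x ⊕ ι y = ι (x + y).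
Proof.
apply: xget_unique; first by exists i, x, y.
by move=> _ [j [x' [y' [xx' yy' ->]]]]; apply/esym/pushout_in_add_congr.
Qed.

Definition same_piece (d d' : D) : Prop := exists i, piece i d /\ piece i d'.

Lemma glue_addP (d d' : D) : same_piece d d' \/ d ⊕ d' = glue_one.
Proof.
have [same|apart] := pselect (same_piece d d'); [by left | right].
apply: xgetPN => s [i [x [y [dE d'E _]]]].
by apply: apart; exists i; rewrite dE d'E; split; apply: piece_in.
Qed.

Lemma glue_complK (d : D) : d^c^c = d.
Proof.
have [i [x _ <-]] := piece_cover e_inj i0 d.
by rewrite !glue_complE (ogpd_complK (ogpdP _)).
Qed.

Lemma glue_add0 (d : D) : glue_one^c ⊕ d = d.
Proof.
have [i [x _ <-]] := piece_cover e_inj i0 d.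
by rewrite (glue_oneE i) glue_complE glue_addE (ogpd_add0 (ogpdP _)).
Qed.

Lemma glue_addx1 (d : D) : d ⊕ glue_one = glue_one.
Proof.
have [i [x _ <-]] := piece_cover e_inj i0 d.
by rewrite (glue_oneE i) glue_addE (ogpd_addx1 (ogpdP _)).
Qed.

Lemma glue_addxC (d : D) : d ⊕ d^c = glue_one.
Proof.
have [i [x _ <-]] := piece_cover e_inj i0 d.
by rewrite glue_complE glue_addE (ogpd_addxC (ogpdP _)) -glue_oneE.
Qed.

Lemma glue_addKl (d d' : D) : d ≼ d ⊕ d'.
Proof.
have [[i [[x _ <-] [y _ <-]]]|->] := glue_addP d d'.
  by rewrite /induced_rel !glue_addE (ogpd_addKl (ogpdP _)).
exact: glue_addx1.
Qed.

Lemma glue_addKr (d d' : D) : d' ≼ d ⊕ d'.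
Proof.
have [[i [[x _ <-] [y _ <-]]]|->] := glue_addP d d'.
  by rewrite /induced_rel !glue_addE (ogpd_addKr (ogpdP _)).
exact: glue_addx1.
Qed.

Lemma piece_one (i : I) : piece i glue_one.
Proof. by rewrite (glue_oneE i); apply: piece_in. Qed.

Lemma piece_compl (i : I) (d : D) : piece i d -> piece i d^c.
Proof. by move=> [x _ <-]; rewrite glue_complE; apply: piece_in. Qed.

Lemma same_piece_one (d : D) : same_piece d glue_one.
Proof.
by have [i di] := piece_cover e_inj i0 d; exists i; split=> //; apply: piece_one.
Qed.

Lemma glue_rel_same_piece (d d' : D) : d ≼ d' -> same_piece d d'.
Proof.
move=> dd'; have [//|dd'1] := glue_addP d d'.
by rewrite -dd' dd'1; apply: same_piece_one.
Qed.

Lemma pushout_in_rel (i : I) (x y : B i) :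
  ι x ≼ ι y -> induced_rel (@ogpd_add (B i)) x y.
Proof. by rewrite /induced_rel glue_addE => /(pushout_in_inj e_inj). Qed.

Lemma glue_eq1 (d z : D) : d ≼ z -> d^c ≼ z -> z = glue_one.
Proof.
move=> dz; have [i [[x _ xd] [y _ yz]]] := glue_rel_same_piece dz.
move: dz; rewrite -xd -yz glue_complE (glue_oneE i).
move=> /pushout_in_rel xy /pushout_in_rel x'y.
by rewrite (ogpd_eq1 (ogpdP _) xy x'y).
Qed.

Lemma glue_compl_anti (z u : D) : z ≼ u -> u^c ≼ z^c.
Proof.
move=> zu; have [i [[x _ xz] [y _ yu]]] := glue_rel_same_piece zu.
move: zu; rewrite -xz -yu !glue_complE => /pushout_in_rel/ogpd_compl_anti xy.
by rewrite /induced_rel glue_addE xy.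
Qed.

Lemma same_piece_triple (z u w : D) :
  same_piece z u -> same_piece z w -> same_piece u w ->
  exists i, [/\ piece i z, piece i u & piece i w].
Proof.
move=> [i [iz iu]] [j [jz jw]] [k [ku kw]].
have [eq_ij|neq_ij] := eqVneq i j; first by subst j; exists i.
by exists k; split=> //; apply: (piece_overlap e_inj k neq_ij).
Qed.

Lemma glue_orth_rel (z u w : D) : z ≼ u -> z ≼ w -> (u^c ⊕ w)^c ⊕ u^c ≼ z^c.
Proof.
move=> zu zw; have [u'w|->] := glue_addP u^c w; last first.
  by rewrite glue_add0; apply: glue_compl_anti.
have uw : same_piece u w.
  by have [i [/piece_compl]] := u'w; rewrite glue_complK; exists i.
have [i [[x _ xz] [y _ yu] [t _ tw]]] :=
  same_piece_triple (glue_rel_same_piece zu) (glue_rel_same_piece zw) uw.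
move: zu zw; rewrite -xz -yu -tw => /pushout_in_rel xy /pushout_in_rel xt.
by rewrite /induced_rel !(glue_complE, glue_addE) (ogpd_orth_rel xy xt).
Qed.

Lemma glue_laws : orthogroupoid_laws glue_add glue_compl glue_one.
Proof.
split.
- exact: glue_complK.
- exact: glue_add0.
- exact: glue_addx1.
- exact: glue_addxC.
- exact: glue_eq1.
- by move=> x y z; apply: glue_orth_rel; apply: glue_addKl.
- exact: glue_addKl.
- exact: glue_addKr.
Qed.

Definition glue : orthogroupoid := Orthogroupoid glue_laws.

Lemma pushout_in_embedding (i : I) :
  @ogpd_embedding (B i) glue (@pushout_in _ _ _ e i).
Proof.
split=> [x y|x||].
- exact/esym/glue_addE.
- exact/esym/glue_complE.
- exact/esym/glue_oneE.
- exact: pushout_in_inj.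
Qed.

Theorem strong_amalgamation_family :
  exists (C : orthogroupoid) (h : forall i, B i -> C),
    [/\ forall i, ogpd_embedding (h i),
        forall i j, h i \o e i = h j \o e j &
        forall i j, i != j -> range (h i) `&` range (h j) = range (h i \o e i)].
Proof.
exists glue, (@pushout_in _ _ _ e); split=> [i|i j|i j neq_ij].
- exact: pushout_in_embedding.
- by apply/funext => a /=; rewrite !pushout_in_base.
- apply/seteqP; split=> [_ [[x _ <-] [y _ /esym]]|_ [a _ <-]].
    by move=> /(pushout_in_meet e_inj neq_ij)[a -> _]; exists a.
  by split; [exists (e i a) | exists (e j a); rewrite //= !pushout_in_base].
Qed.

End Gluing.

Theorem theorem4p1 (A B1 B2 : orthogroupoid) (i : A -> B1) (j : A -> B2)
    (hA : [set: A] <> set0)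
    (hi : ogpd_embedding i) (hj : ogpd_embedding j) :
  exists (D : orthogroupoid) (h : B1 -> D) (k : B2 -> D),
    [/\ ogpd_embedding h, ogpd_embedding k,
        h \o i = k \o j,
        h @` (range i) = k @` (range j) &
        k @` (range j) = range h `&` range k].
Proof.
pose B b := if b then B1 else B2.
pose e b : A -> B b := if b return A -> B b then i else j.
have he b : ogpd_embedding (e b) by case: b.
have [D [h [h_emb h_glue h_meet]]] := strong_amalgamation_family true he.
have hi_kj : h true \o i = h false \o j := h_glue true false.
exists D, (h true), (h false); split=> //.
- exact: (h_emb true).
- exact: (h_emb false).
- by rewrite !image_comp hi_kj.
- by rewrite image_comp -hi_kj; apply/esym/(h_meet true false).
Qed.
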